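(* Let $n\ge 1$ and $T\ge 1$ be integers, and let $R$ be an arbitrary simply connected region of the square lattice which is a union of $nT$ unit squares. Then the number of tilings of $R$ by $n$-ribbons satisfies $|\mathcal{T}_n(R)| \le 2^{(n-1)T}$. In particular, for an arbitrary sequence of such regions $(R_t)_{t=1}^\infty$ with areas $A_t\to\infty$, $$\limsup_{t\to\infty}\frac{\log_2|\mathcal{T}_n(R_t)|}{A_t/n}\le n-1 .$$
   Context: A region $R\subset\mathbb{R}^2$ is a union of finitely many unit squares $[k,k+1]\times[l,l+1]$ with $k,l\in\mathbb{Z}$, whose interior is connected and simply connected. An $n$-ribbon is a connected sequence of $n$ unit squares (of the lattice), each of which (except the first) lies directly above or directly to the right of its predecessor. A tiling of $R$ by $n$-ribbons is a set of $n$-ribbons with pairwise disjoint interiors whose union is $R$. $\mathcal{T}_n(R)$ denotes the set of all tilings of $R$ by $n$-ribbons. Convention: $\log_2 0=-\infty$. *)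

(* Defs.v *)
From HB Require Import structures.
From mathcomp Require Import all_boot all_order all_algebra finmap.
From mathcomp Require Import all_classical all_reals all_analysis.

Set Implicit Arguments.
Unset Strict Implicit.
Unset Printing Implicit Defensive.

Import Order.TTheory GRing.Theory Num.Theory.
Import numFieldNormedType.Exports.

Local Open Scope classical_set_scope.
Local Open Scope ring_scope.

(* Paths are total functions on R, of which only the restriction to [0, 1]
   matters; likewise homotopies are total functions on R * R. *)
Definition path_connected (R : realType) (U : topologicalType) (A : set U) :=
  forall x y, A x -> A y ->
  exists g : R -> U,
    [/\ {within `[0, 1], continuous g}, g 0 = x, g 1 = y &
        forall s, s \in `[0, 1] -> A (g s)].

Definition loops_contract (R : realType) (U : topologicalType) (A : set U) :=
  forall g : R -> U,
    {within `[0, 1], continuous g} -> g 0 = g 1 ->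
    (forall s, s \in `[0, 1] -> A (g s)) ->
  exists h : R * R -> U,
    [/\ {within `[0, 1] `*` `[0, 1], continuous h},
        (forall s u, s \in `[0, 1] -> u \in `[0, 1] -> A (h (s, u))),
        (forall s, s \in `[0, 1] -> h (s, 0) = g s),
        (forall s, s \in `[0, 1] -> h (s, 1) = g 0) &
        (forall u, u \in `[0, 1] -> h (0, u) = g 0 /\ h (1, u) = g 0)].

Definition simply_connected (R : realType) (U : topologicalType) (A : set U) :=
  path_connected R A /\ loops_contract R A.

(* A lattice square is named by the integer coordinates of its lower left
   corner. *)
Notation cell := (int * int)%type.

Definition unit_square (R : realType) (c : cell) : set (R * R) :=
  `[c.1%:~R, c.1%:~R + 1] `*` `[c.2%:~R, c.2%:~R + 1].
Arguments unit_square : clear implicits.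

Definition squares_union (R : realType) (C : set cell) : set (R * R) :=
  \bigcup_(c in C) unit_square R c.
Arguments squares_union : clear implicits.

Definition union_of_squares (R : realType) (N : nat) (D : set (R * R)) :=
  exists2 C : {fset cell}, #|` C| = N & D = squares_union R [set` C].

Definition region (R : realType) (D : set (R * R)) :=
  [/\ exists N, union_of_squares N D,
      connected D° & simply_connected R D°].

Definition ribbon_step : rel cell := fun c d =>
  (d == (c.1, c.2 + 1)) || (d == (c.1 + 1, c.2)).

Definition ribbon (n : nat) (s : seq cell) : bool :=
  (size s == n) && sorted ribbon_step s.

Definition ribbon_body (R : realType) (s : seq cell) : set (R * R) :=
  squares_union R [set` s].
Arguments ribbon_body : clear implicits.

Definition tilings (R : realType) (n : nat) (D : set (R * R)) :
    set (set (seq cell)) :=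
  [set F | [/\ forall s, F s -> ribbon n s,
               trivIset F (fun s => (ribbon_body R s)°) &
               \bigcup_(s in F) ribbon_body R s = D]].

(* Meaningful only when [tilings n D] is finite: [fset_set] is empty on
   infinite sets. *)
Definition num_tilings (R : realType) (n : nat) (D : set (R * R)) : nat :=
  #|` fset_set (tilings n D)|.

Definition area (R : realType) (D : set (R * R)) : \bar R :=
  (@lebesgue_measure R \x @lebesgue_measure R)%E D.

(* [lne] sends 0 to -oo, hence so does [log2e]. *)
Definition log2e (R : realType) (x : \bar R) : \bar R :=
  (lne x / (ln 2)%:E)%E.

(* Main.v *)
Require Import Defs.
From mathcomp Require Import all_boot all_order all_algebra finmap.
From mathcomp Require Import all_classical all_reals all_analysis.
From mathcomp Require Import zify lra.

Import Order.TTheory GRing.Theory Num.Theory.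
Import numFieldNormedType.Exports.

Local Open Scope classical_set_scope.
Local Open Scope ring_scope.

(** Order the squares by level x + y, which increases by 1 along a ribbon. While
    a tiling is uncovered ribbon by ribbon, a remaining square of minimal level
    can only be the first square of its ribbon, so 2 ^ (n - 1) choices determine
    that ribbon; after T steps the tiling is determined. *)

(** * Ribbons and the level function *)

Definition level (c : cell) : int := c.1 + c.2.

Lemma level_step (c d : cell) : ribbon_step c d -> level c < level d.
Proof. by case: c d => [a b] [c d] /orP[] /eqP[-> ->]; rewrite /level /=; lia. Qed.

Lemma ribbon_level_sorted (n : nat) (s : seq cell) :
  ribbon n s -> sorted <%O (map level s).
Proof.
move=> /andP[_]; case: s => //= c s.
by elim: s c => //= d s IH c /andP[/level_step -> /IH].
Qed.

Lemma ribbon_uniq (n : nat) (s : seq cell) : ribbon n s -> uniq s.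
Proof. by move/ribbon_level_sorted/lt_sorted_uniq/map_uniq. Qed.

(** Levels increase strictly along a ribbon, so every square after the first lies strictly above the
    level of [d]. *)
Lemma ribbon_root_min (n : nat) (d : cell) (s : seq cell) (c : cell) :
  ribbon n (d :: s) -> c \in d :: s -> level c <= level d -> c = d.
Proof.
move=> /ribbon_level_sorted /=; rewrite (path_sortedE lt_trans) => /andP[/allP h _].
rewrite inE => /predU1P[//|cs]; rewrite leNgt => /negP[].
by apply: h; exact: map_f.
Qed.

(** The starting square [c] is left out of each list: a ribbon rooted at [c] is [c :: s] with [s]
    among these tails. *)
Fixpoint ribbon_tails (k : nat) (c : cell) : seq (seq cell) :=
  if k is k'.+1 then
    flatten [seq map (cons d) (ribbon_tails k' d)
            | d <- [:: (c.1, c.2 + 1); (c.1 + 1, c.2)]]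
  else [:: [::]].

Lemma size_ribbon_tails (k : nat) (c : cell) :
  size (ribbon_tails k c) = (2 ^ k)%N.
Proof.
by elim: k c => //= k IH c; rewrite cats0 size_cat !size_map !IH addnn -mul2n -expnS.
Qed.

Lemma mem_ribbon_tails (k : nat) (c : cell) (s : seq cell) :
  ribbon k.+1 (c :: s) -> s \in ribbon_tails k c.
Proof.
elim: k c s => [|k IH] c [|d s] //=; rewrite /ribbon /= eqSS.
move=> /andP[sz /andP[cd ds]].
have /IH sd : ribbon k.+1 (d :: s) by rewrite /ribbon /= sz.
by rewrite cats0 mem_cat; case/orP: cd => /eqP <-; rewrite map_f ?orbT.
Qed.

(** * Combinatorial tilings and their count *)

Record cell_tiling (n : nat) (C : {fset cell}) (F : set (seq cell)) : Prop :=
  CellTiling {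
    cell_tiling_ribbon : forall s, F s -> ribbon n s;
    cell_tiling_sub : forall s, F s -> {subset s <= C};
    cell_tiling_cover : forall c, c \in C -> exists2 s, F s & c \in s;
    cell_tiling_disjoint : forall s t c,
      F s -> F t -> c \in s -> c \in t -> s = t }.

(** Length [n.+1] makes ribbons nonempty, so a member would put a square in [fset0]. For length 0
    the family [[set [::]]] would also qualify. *)
Lemma cell_tiling0 (n : nat) (F : set (seq cell)) :
  cell_tiling n.+1 fset0 F -> F = set0.
Proof.
move=> tF; apply/seteqP; split=> // -[|c s] Fs.
  by have := cell_tiling_ribbon _ _ _ tF _ Fs.
by have := cell_tiling_sub _ _ _ tF _ Fs c (mem_head _ _); rewrite inE.
Qed.

Lemma cell_tilingD (n : nat) (C : {fset cell}) (F : set (seq cell)) (s : seq cell) :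
  cell_tiling n.+1 C F -> F s ->
  cell_tiling n.+1 [fset c in C | c \notin s]%fset (F `\ s).
Proof.
move=> [rF sF cF dF] Fs; split.
- by move=> t [/rF].
- move=> t [Ft ts] c ct; rewrite !inE /= (sF _ Ft) //=.
  by apply/negP => cs; apply: ts; apply: (dF _ _ c).
- move=> c; rewrite !inE /= => /andP[/cF[t Ft ct] cs].
  by exists t => //; split=> // ts; rewrite -ts ct in cs.
- by move=> t u c [Ft _] [Fu _]; exact: dF.
Qed.

Lemma exists_min_level (C : {fset cell}) (c0 : cell) : c0 \in C ->
  exists2 c, c \in C & forall d, d \in C -> level c <= level d.
Proof.
move=> c0C.
pose i0 : C := [` c0C]%fset.
have [i _ imin] := @arg_minP _ _ C i0 xpredT (fun i : C => level (val i)) isT.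
exists (val i); first exact: valP.
by move=> d dC; exact: (imin [` dC]%fset).
Qed.

(** Induction on the number of ribbons left. A list containing all tilings gives finiteness and the
    bound at once. *)
Lemma cell_tilings_bound (n T : nat) (C : {fset cell}) : (#|` C| <= n.+1 * T)%N ->
  exists2 L : seq (set (seq cell)), (size L <= 2 ^ (n * T))%N &
    forall F, cell_tiling n.+1 C F -> F \in L.
Proof.
elim: T C => [|T IH] C.
  rewrite muln0 leqn0 => /eqP/cardfs0_eq ->; exists [:: set0].
    by rewrite muln0.
  by move=> F /cell_tiling0 ->; rewrite inE.
move=> CT; have [->|/fset0Pn[c0 c0C]] := eqVneq C fset0.
  exists [:: set0]; first by rewrite expn_gt0.
  by move=> F /cell_tiling0 ->; rewrite inE.
have [c cC cmin] := exists_min_level _ _ c0C.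
pose good (s : seq cell) := ribbon n.+1 s && all (mem C) s.
pose rest (s : seq cell) := [fset d in C | d \notin s]%fset.
(* Stated for every [s], with the empty list when [s] is not [good], so that [choice] yields a
   single function [f]. *)
have extend s : exists L : seq (set (seq cell)), (size L <= 2 ^ (n * T))%N /\
    (good s -> forall F, cell_tiling n.+1 (rest s) F -> F \in L).
  have [/andP[rs /allP sC]|_] := boolP (good s); last by exists [::].
  have [|L sL LP] := IH (rest s); last by exists L.
  have -> : rest s = (C `\` [fset d in s])%fset.
    by apply/fsetP => d; rewrite !inE andbC.
  have sub : ([fset d in s] `<=` C)%fset by apply/fsubsetP => d; rewrite inE; exact: sC.
  (* The squares of [s] are distinct and lie in [C], so exactly [n.+1] squares are removed. *)
  rewrite cardfsD (fsetIidPr sub) card_fseq undup_id ?(ribbon_uniq _ _ rs)//.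
  by case/andP: rs => /eqP -> _; lia.
have [f fP] := choice extend.
(* Each of the [2 ^ n] candidate ribbons rooted at [c] is put back into the at most [2 ^ (n * T)]
   listed tilings of what it leaves uncovered. *)
exists (flatten [seq map (setU [set c :: s]) (f (c :: s)) | s <- ribbon_tails n c]).
  rewrite mulnS expnD -(size_ribbon_tails n c).
  elim: (ribbon_tails n c) => //= s l IHl.
  by rewrite size_cat size_map mulSn leq_add // (fP _).1.
move=> F tF; have [s Fs cs] := cell_tiling_cover _ _ _ tF _ cC.
have rs := cell_tiling_ribbon _ _ _ tF _ Fs.
have sC := cell_tiling_sub _ _ _ tF _ Fs.
case: s => [//|d s] in Fs cs rs sC *.
(* The root [d] lies in [C], so minimality of [c] gives [level c <= level d]. *)
have cd : c = d.
  by apply: (ribbon_root_min _ _ _ _ rs cs); apply/cmin/sC/mem_head.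
subst d.
apply/flattenP => /=; exists (map (setU [set c :: s]) (f (c :: s))).
  by apply: map_f; exact: mem_ribbon_tails.
have -> : F = [set c :: s] `|` (F `\ (c :: s)).
  by rewrite setDUK // => x ->.
apply: map_f; apply: (fP (c :: s)).2; last exact: cell_tilingD.
by rewrite /good rs; apply/allP.
Qed.

(** * From plane tilings to combinatorial ones *)

(** A test point: it is interior to its own square and lies in no other closed square, so membership
    of cells can be read off from sets in the plane. *)
Definition center (R : realType) (c : cell) : R * R :=
  (c.1%:~R + 2^-1, c.2%:~R + 2^-1).

Lemma unit_square_center (R : realType) (c d : cell) :
  unit_square R d (center R c) -> d = c.
Proof.
have int_eq (a b : int) : b%:~R <= a%:~R + 2^-1 :> R ->
    a%:~R + 2^-1 <= b%:~R + 1 :> R -> b = a.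
  move=> h1 h2.
  have : b%:~R < (a + 1)%:~R :> R by rewrite intrD; lra.
  have : a%:~R < (b + 1)%:~R :> R by rewrite intrD; lra.
  rewrite !ltr_int; lia.
case: c d => [a b] [a' b'] [] /=; rewrite !in_itv /= => /andP[? ?] /andP[? ?].
by congr pair; apply: int_eq.
Qed.

Lemma center_interior (R : realType) (c : cell) :
  (unit_square R c)° (center R c).
Proof.
have H (a : int) : nbhs (a%:~R + 2^-1 : R) `[a%:~R : R, a%:~R + 1]%classic.
  apply: (@filterS _ _ _ `]a%:~R : R, a%:~R + 1[%classic).
    exact: subset_itv_oo_cc.
  apply: open_nbhs_nbhs; split; first exact: interval_open.
  by rewrite /= in_itv /=; lra.
by exists (`[c.1%:~R : R, c.1%:~R + 1]%classic, `[c.2%:~R : R, c.2%:~R + 1]%classic); first by split; exact: H.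
Qed.

Lemma squares_union_center (R : realType) (C : set cell) (c : cell) :
  squares_union R C (center R c) <-> C c.
Proof.
split=> [[d Cd /unit_square_center <-]//|Cc].
by exists c => //; apply: interior_subset; exact: center_interior.
Qed.

(** Every condition is tested at centers. In particular, two ribbons sharing a cell have its center
    in both interiors, so [trivIset] makes them equal. *)
Lemma tilings_cell_tiling (R : realType) (n : nat) (C : {fset cell})
    (F : set (seq cell)) :
  tilings n (squares_union R [set` C]) F -> cell_tiling n C F.
Proof.
move=> [rF dF cF]; split=> //.
- move=> s Fs c cs; apply/(squares_union_center R [set` C]).
  by rewrite -cF; exists s => //; apply/squares_union_center.
- move=> c /(squares_union_center R [set` C]); rewrite -cF => -[s Fs].
  by move=> /squares_union_center cs; exists s.
- move=> s t c Fs Ft cs ct; apply: dF => //; exists (center R c).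
  have sub u : c \in u -> (ribbon_body R u)° (center R c).
    move=> cu; apply: (interiorS _ (center_interior R c)).
    by move=> x xc; exists c.
  by split; exact: sub.
Qed.

Lemma num_tilings_bound (R : realType) (n T : nat) (D : set (R * R)) :
  (0 < n)%N -> union_of_squares (n * T) D ->
  finite_set (tilings n D) /\ (num_tilings n D <= 2 ^ ((n - 1) * T))%N.
Proof.
case: n => // n _ [C cC ->]; rewrite subn1 /=.
have [|L sL LP] := cell_tilings_bound n T C; first by rewrite cC.
have sub : tilings n.+1 (squares_union R [set` C]) `<=` [set` [fset F in L]%fset].
  by move=> F /tilings_cell_tiling/LP FL; rewrite /= inE.
have fin := sub_finite_set sub (finite_fset _).
split=> //; apply: leq_trans sL; rewrite /num_tilings.
have := sub; rewrite fset_set_sub// ?set_fsetK.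
move=> /fsubset_leq_card /leq_trans; apply.
by rewrite card_fseq size_undup.
Qed.

(** * Area of a union of lattice squares *)

(* Half-open for [b = true] (so that distinct cells give disjoint sets), closed
   for [b = false]. *)
Definition unit_itv (R : realType) (b : bool) (a : int) : set R :=
  [set` Interval (BLeft a%:~R) (BSide b (a%:~R + 1))].

Definition side_square (R : realType) (b : bool) (c : cell) : set (R * R) :=
  unit_itv R b c.1 `*` unit_itv R b c.2.

Lemma measurable_side_square (R : realType) (b : bool) (c : cell) :
  measurable (side_square R b c).
Proof. by apply: measurableX; exact: measurable_itv. Qed.

Lemma area_side_square (R : realType) (b : bool) (c : cell) :
  area (side_square R b c) = 1%E.
Proof.
have H (a : int) : lebesgue_measure (unit_itv R b a) = 1%E.
  by rewrite lebesgue_measure_itv /= lte_fin ltrDl ltr01 -EFinB addrAC subrr add0r.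
rewrite /area product_measure1E; [|exact: measurable_itv..].
by rewrite [X in (X * _)%E]H [X in (_ * X)%E]H mule1.
Qed.

Lemma trivIset_side_square (R : realType) (D : set cell) :
  trivIset D (side_square R true).
Proof.
have int_eq (a b : int) (x : R) : unit_itv R true a x -> unit_itv R true b x -> a = b.
  rewrite /unit_itv /= !in_itv /= => /andP[? ?] /andP[? ?].
  have : b%:~R < (a + 1)%:~R :> R by rewrite intrD; lra.
  have : a%:~R < (b + 1)%:~R :> R by rewrite intrD; lra.
  rewrite !ltr_int; lia.
move=> [a b] [c d] _ _ [[x y] [[/= ax bx] [/= cx dx]]].
by congr pair; [exact: int_eq ax cx|exact: int_eq bx dx].
Qed.

(** Subadditivity over the closed squares bounds the area above; additivity over the disjoint
    half-open squares inside them bounds it below. Overlaps of boundaries thus need no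
    computation. *)
Lemma area_union_of_squares (R : realType) (N : nat) (D : set (R * R)) :
  union_of_squares N D -> area D = N%:R%:E.
Proof.
move=> [C <- ->].
have sumE b : (\sum_(c \in [set` C]) area (side_square R b c) = #|` C|%:R%:E)%E.
  rewrite fsbig_finite /=; last exact: finite_fset.
  rewrite set_fsetK (eq_bigr (fun=> 1%E)); last by move=> c _; exact: area_side_square.
  by rewrite sumEFin big_const_seq count_predT iter_addr_0.
have mU b : measurable (\bigcup_(c in [set` C]) side_square R b c).
  by apply: fin_bigcup_measurable => // c _; exact: measurable_side_square.
apply/eqP; rewrite eq_le; apply/andP; split.
  rewrite -(sumE false); apply: content_sub_fsum => //; last exact: (mU false).
  by move=> c _; exact: measurable_side_square.
rewrite -(sumE true) /area -measure_fin_bigcup//.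
- apply: le_measure; rewrite ?inE; [exact: mU|exact: (mU false)|].
  have sub (a : int) : unit_itv R true a `<=` unit_itv R false a.
    by move=> x; rewrite /unit_itv /= !in_itv /= => /andP[-> /ltW].
  by apply: subset_bigcup => c _ x [/sub x1 /sub x2].
- exact: trivIset_side_square.
- by move=> c _; exact: measurable_side_square.
Qed.

(** * Logarithms and the upper limit *)

Lemma log2e_le (R : realType) (m k : nat) :
  (m <= 2 ^ k)%N -> (log2e (m%:R%:E : \bar R) <= k%:R%:E)%E.
Proof.
move=> mk; have ln2 : 0 < ln 2 :> R by rewrite ln_gt0 ?ltr1n.
rewrite /log2e inver gt_eqF// lee_pdivrMr//.
(* For [m = 0] the logarithm is [-oo]. *)
have [->|m0] := posnP m; first by rewrite le0_lneNy ?leNye.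
rewrite /= lern0 gtn_eqF// lee_fin.
rewrite mulr_natl -lnXn//.
by rewrite ler_ln ?posrE ?ltr0n ?exprn_gt0 // -natrX ler_nat.
Qed.

Lemma limn_esup_le (R : realType) (u : (\bar R)^nat) (l : \bar R) :
  (forall k, (u k <= l)%E) -> (limn_esup u <= l)%E.
Proof.
move=> ul; rewrite /limn_esup limf_esupE.
(* The upper limit is an infimum of suprema over the sets of the filter; the whole of [nat] is one
   such set. *)
apply: (@le_trans _ _ (ereal_sup [set u x | x in setT])).
  by apply: ereal_inf_lbound; exists setT => //; exact: filterT.
by apply: ub_ereal_sup => _ [k _ <-].
Qed.

Theorem theorem2p1 (R : realType) (n : nat) (hn : (1 <= n)%N) :
  (forall (T : nat) (D : set (R * R)),
     (1 <= T)%N -> region D -> union_of_squares (n * T) D ->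
     finite_set (tilings n D) /\
     (num_tilings n D <= 2 ^ ((n - 1) * T))%N) /\
  (forall D : nat -> set (R * R),
     (forall t, region (D t)) ->
     (forall t, exists2 T : nat, (1 <= T)%N & union_of_squares (n * T) (D t)) ->
     area (D t) @[t --> \oo] --> +oo%E ->
     (limn_esup (fun t =>
        log2e (num_tilings n (D t))%:R%:E / (area (D t) / n%:R%:E))
      <= (n%:R - 1)%:E)%E).
Proof.
split=> [T D _ _ DT|D _ DT _]; first exact: num_tilings_bound.
apply: limn_esup_le => t; have [T T0 DtT] := DT t.
have [_ /log2e_le le] := num_tilings_bound _ _ _ _ hn DtT.
rewrite (area_union_of_squares _ _ _ DtT).
have n0 : n%:R != 0 :> R by rewrite pnatr_eq0 -lt0n.
have T0' : 0 < T%:R :> R by rewrite ltr0n.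
(* The area is [n * T], so the denominator is the number [T] of ribbons. *)
rewrite [X in (_ / X)%E](_ : _ = T%:R%:E); last first.
  by rewrite inver (negPf n0) -EFinM natrM mulrAC mulfV// mul1r.
rewrite inver gt_eqF// lee_pdivrMr//; apply: le_trans (le _) _.
(* Since [1 <= n], the truncated difference [n - 1] in the exponent agrees with the real one. *)
by rewrite -EFinM natrM natrB.
Qed.
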